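(* Let $R \geq 2$ be an integer. (i) The proportion of $\mathcal{G} \in \mathbf{G}_{n,R}$ which have no vertex with degree less than $R-2$ approaches $1$ as $n \to \infty$. (ii) For every real $\varepsilon > 0$, the proportion of $\mathcal{G} \in \mathbf{G}_{n,R}$ which have between $\sqrt{(R-\varepsilon)n}$ and $\sqrt{(R+\varepsilon)n}$ vertices with degree $R-1$ approaches $1$ as $n \to \infty$. (iii) For every $k \in \mathbb{N}$, the proportion of $\mathcal{G} \in \mathbf{G}_{n,R}$ which have exactly $k$ vertices with degree $R-2$ approaches $$\frac{(R-1)^k \, e^{-(R-1)}}{k!} \qquad \text{as } n \to \infty.$$ In other words, the number of vertices with degree $R-2$ has, asymptotically, a Poisson distribution with mean $R-1$.
   Context: A graph is a finite undirected graph without loops or multiple edges. For positive integers $n$ and $R$, $\mathbf{G}_{n,R}$ denotes the set of graphs with vertex set $\{1,\ldots,n\}$ in which the degree of every vertex is at most $R$. The proportion of $\mathcal{G} \in \mathbf{G}_{n,R}$ with a property $P$ is $|\{\mathcal{G} \in \mathbf{G}_{n,R} : \mathcal{G} \text{ has } P\}| / |\mathbf{G}_{n,R}|$. $\mathbb{N}$ is the set of non-negative integers. If $\varepsilon > R$, the lower bound $\sqrt{(R-\varepsilon)n}$ is read as $0$. *)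

(* Defs.v *)
From mathcomp Require Import all_boot all_order all_algebra.
From mathcomp Require Import reals topology normedtype sequences exp.

Set Implicit Arguments.
Unset Strict Implicit.
Unset Printing Implicit Defensive.

Import Order.TTheory GRing.Theory Num.Theory.
Import numFieldNormedType.Exports.

(* A graph on the vertex set 'I_n (standing for {1, ..., n}) is given by its
   set of edges, each edge being an unordered pair of distinct vertices. *)
Definition is_graph (n : nat) (E : {set {set 'I_n}}) : bool :=
  [forall e in E, #|e| == 2].

Definition degree (n : nat) (E : {set {set 'I_n}}) (v : 'I_n) : nat :=
  #|[set e in E | v \in e]|.

Definition bounded_graphs (n R : nat) : {set {set {set 'I_n}}} :=
  [set E | is_graph E && [forall v, degree E v <= R]].

Definition num_degree (n : nat) (E : {set {set 'I_n}}) (d : nat) : nat :=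
  #|[set v | degree E v == d]|.

Definition proportion (K : realType) (n R : nat)
    (P : {set {set 'I_n}} -> bool) : K :=
  (#|[set E in bounded_graphs n R | P E]|%:R / #|bounded_graphs n R|%:R)%R.

(* Main.v *)
Require Import Defs.
From mathcomp Require Import all_boot all_order all_algebra.
From mathcomp Require Import boolp reals topology normedtype sequences exp.
From mathcomp Require Import ring lra zify.
Import Order.TTheory GRing.Theory Num.Theory.
Import numFieldNormedType.Exports.
Local Open Scope classical_set_scope.
Local Open Scope ring_scope.

(** Write d = R n - 2|E| for the total deficiency of a graph, and a, q, c for
    the numbers of vertices of degree R - 1, at most R - 2, at most R - 3.
    Expectations are over a uniform graph in G_{n,R}; everything follows from
    two double counts.

    Deleting an edge, respectively adding one between two nonadjacent deficient
    vertices, gives E[h(d + 2) (R n - d)] = E[h(d) P] for every h, where P is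
    the number of ordered nonadjacent pairs of deficient vertices.  Up to terms
    of order d (1 + q), P equals d^2.  Taking h(x) = x^2 bounds E[d^4] by
    O(n^2); h = 1 and h(x) = x give E[(d - r)^2 (d + r)] = O(n) with
    r^2 = R n, so that E|a^2 - R n| = O(n^{3/4}).

    Replacing an edge xy, with x of full degree, by vy, with v deficient,
    preserves d.  Counting these switchings with v of deficiency at least 2,
    respectively 3, yields E[d^i q] = O(n^{i/2}) and E[c] = O(n^{-1/2}).  With v
    of deficiency exactly 2 it yields (k + 1) p_{k+1} - (R - 1) p_k -> 0 for
    p_k = P(exactly k vertices of degree R - 2); since E[q] is bounded, no mass
    escapes and the limit is Poisson.

    To avoid fractional powers, rates are expressed with u such that u^4 = n. *)

Set Implicit Arguments.
Unset Strict Implicit.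
Unset Printing Implicit Defensive.

(** * Toggling one edge: effect on degrees, size and being a graph *)

(** One total involution covers both insertion and deletion, so sums over edge sets can be reindexed
    by it with no side condition. *)
Definition edge_toggle (n : nat) (e : {set 'I_n}) (E : {set {set 'I_n}}) :=
  if e \in E then (E :\ e)%SET else (e |: E)%SET.

Lemma edge_toggleK n (e : {set 'I_n}) : involutive (edge_toggle e).
Proof.
move=> E; rewrite /edge_toggle; case: (boolP (e \in E)) => eE.
  by rewrite !inE eqxx /= finset.setD1K.
by rewrite finset.setU11 finset.setU1K.
Qed.

Lemma in_edge_toggle n (e f : {set 'I_n}) (E : {set {set 'I_n}}) :
  (f \in edge_toggle e E) = (f \in E) (+) (f == e).
Proof.
rewrite /edge_toggle; case: ifPn => eE; rewrite !inE.
  by case: eqVneq => [->|] /=; rewrite ?eE ?addbF.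
by case: eqVneq => [->|] /=; rewrite ?(negbTE eE) ?addbF.
Qed.

Lemma degree_toggle_in n (e : {set 'I_n}) (E : {set {set 'I_n}}) w :
  e \in E -> (degree (edge_toggle e E) w + (w \in e) = degree E w)%N.
Proof.
move=> eE; rewrite /degree; case: (boolP (w \in e)) => we.
  rewrite (cardsD1 e [set f in E | w \in f]) inE eE we /= addnC; congr addn.
  apply: eq_card => f; rewrite !inE in_edge_toggle.
  by case: eqVneq => [->|]; rewrite ?eE ?addbF.
rewrite addn0; apply: eq_card => f; rewrite !inE in_edge_toggle.
by case: eqVneq => [->|]; rewrite ?(negbTE we) ?andbF ?addbF.
Qed.

Lemma degree_toggle_notin n (e : {set 'I_n}) (E : {set {set 'I_n}}) w :
  e \notin E -> (degree (edge_toggle e E) w = degree E w + (w \in e))%N.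
Proof.
move=> eE; rewrite -{2}(edge_toggleK e E) degree_toggle_in //.
by rewrite in_edge_toggle (negbTE eE) eqxx.
Qed.

Lemma card_toggle_in n (e : {set 'I_n}) (E : {set {set 'I_n}}) :
  e \in E -> (#|edge_toggle e E| + 1 = #|E|)%N.
Proof. by move=> eE; rewrite /edge_toggle eE (cardsD1 e E) eE addnC. Qed.

Lemma card_toggle_notin n (e : {set 'I_n}) (E : {set {set 'I_n}}) :
  e \notin E -> (#|edge_toggle e E| = #|E| + 1)%N.
Proof. by move=> eE; rewrite /edge_toggle (negbTE eE) cardsU1 eE addnC. Qed.

Lemma is_graph_toggle n (e : {set 'I_n}) (E : {set {set 'I_n}}) :
  #|e| = 2%N -> is_graph (edge_toggle e E) = is_graph E.
Proof.
have aux F : #|e| = 2%N -> is_graph F -> is_graph (edge_toggle e F).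
  move=> e2 /forall_inP gF; apply/forall_inP => f; rewrite in_edge_toggle.
  by case: eqVneq => [-> _|_]; [rewrite e2 | rewrite addbF; exact: gF].
move=> e2; apply/idP/idP; last exact: aux.
by move=> /(aux _ e2); rewrite edge_toggleK.
Qed.

Lemma graph_edge_neq n (E : {set {set 'I_n}}) x y :
  is_graph E -> [set x; y]%SET \in E -> x != y.
Proof. by move=> /forall_inP gE /gE; rewrite cards2; case: (x == y). Qed.

(** The map sending y to {v, y} is injective even at y = v, where it gives a singleton, and a graph
    contains no singleton; so incident edges correspond to neighbours. *)
Lemma degree_neighbours n (E : {set {set 'I_n}}) v :
  is_graph E -> degree E v = #|[set y | [set v; y]%SET \in E]%SET|.
Proof.
move=> gE; rewrite /degree.
have inj : injective (fun y : 'I_n => [set v; y]%SET).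
  move=> y z /setP yz; move: (yz y) (yz z); rewrite !inE !eqxx !orbT.
  by case: (eqVneq y z) => [//|yz' /=]; rewrite !orbF => /esym/eqP -> /eqP ->.
rewrite -(card_imset _ inj); apply: eq_card => e; rewrite inE.
apply/andP/imsetP => [[eE ve]|[y]]; last first.
  by rewrite inE => yE ->; rewrite yE !inE eqxx.
move/forall_inP: gE => /(_ e eE) /cards2P [a [b [ab eab]]].
move: ve eE; rewrite eab !inE => /orP[] /eqP ->.
  by exists b => //; rewrite inE.
by exists a; rewrite ?inE finset.setUC.
Qed.

Lemma handshake n (E : {set {set 'I_n}}) :
  is_graph E -> (\sum_v degree E v = 2 * #|E|)%N.
Proof.
move=> gE; under eq_bigr do rewrite /degree -sum1dep_card big_mkcondr /=.
rewrite exchange_big /= mulnC -sum_nat_const; apply: eq_bigr => e eE.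
by rewrite -big_mkcond sum1_card; apply/eqP; move/forall_inP: gE; apply.
Qed.

Lemma bounded_graphsP n R (E : {set {set 'I_n}}) :
  reflect (is_graph E /\ forall v, (degree E v <= R)%N) (E \in bounded_graphs n R).
Proof. by rewrite inE; apply: (iffP andP) => -[gE /forallP]. Qed.

(** * Deficiency, and the double count of edge deletions against additions *)

(** For j = 1 these are all deficient vertices; j = 2 and j = 3 give q and c of the overview. The
    additive form avoids truncated subtraction. *)
Definition num_deficient (n R j : nat) (E : {set {set 'I_n}}) : nat :=
  #|[set v | degree E v + j <= R]%N|.

(** Defined from the edge count, so that a toggle visibly shifts it by 2 and a switch preserves it;
    for graphs it is the sum of the vertex deficiencies by the handshake identity. *)
Definition deficiency (K : realType) (n R : nat) (E : {set {set 'I_n}}) : K :=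
  (R * n)%:R - (2 * #|E|)%:R.

(** Pairs are ordered, hence each addable edge counts twice, matching the count 2|E| of ordered
    adjacent pairs. *)
Definition addable_pairs (K : realType) (n R : nat) (E : {set {set 'I_n}}) : K :=
  \sum_(x : 'I_n) \sum_(y : 'I_n)
    ([&& x != y, [set x; y]%SET \notin E, degree E x < R & degree E y < R]%N)%:R.

Lemma natr_card (K : realType) (T : finType) (P : pred T) :
  #|[set x | P x]|%:R = \sum_x (P x)%:R :> K.
Proof.
by rewrite -sum1dep_card natr_sum big_mkcond; apply: eq_bigr => x _; case: (P x).
Qed.

Lemma deficiency_sum (K : realType) n R (E : {set {set 'I_n}}) :
  is_graph E -> deficiency K R E = \sum_v (R%:R - (degree E v)%:R).
Proof.
move=> gE; rewrite /deficiency -handshake // sumrB sumr_const card_ord natr_sum.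
by rewrite natrM mulr_natr.
Qed.

Lemma sum_edges_at (K : realType) n (E : {set {set 'I_n}}) v :
  is_graph E -> \sum_y ([set v; y]%SET \in E)%:R = (degree E v)%:R :> K.
Proof. by move=> gE; rewrite degree_neighbours // natr_card. Qed.

Lemma bounded_toggleE n R (E : {set {set 'I_n}}) x y :
  E \in bounded_graphs n R -> [set x; y]%SET \notin E ->
  (edge_toggle [set x; y]%SET E \in bounded_graphs n R) =
    [&& x != y, degree E x < R & degree E y < R]%N.
Proof.
move=> /bounded_graphsP[gE dE] eE.
have dT w := degree_toggle_notin w eE.
apply/bounded_graphsP/and3P => [[gT dT']|[xy dx dy]].
  move: (dT' x) (dT' y); rewrite !dT !inE !eqxx orbT /= !addn1 => -> ->.
  split=> //; apply: graph_edge_neq gT _.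
  by rewrite in_edge_toggle (negbTE eE) eqxx.
split=> [|w]; first by rewrite is_graph_toggle // cards2 xy.
rewrite dT !inE; case: eqVneq => [->|_]; first by rewrite addn1.
by case: eqVneq => [->|_]; rewrite ?addn1 ?addn0.
Qed.

(** Toggling xy is a bijection from the bounded graphs containing xy onto those to which xy can be
    added. *)
Lemma sum_toggle (K : realType) n R (x y : 'I_n) (h : {set {set 'I_n}} -> K) :
  \sum_(E in bounded_graphs n R) ([set x; y]%SET \in E)%:R * h (edge_toggle [set x; y]%SET E) =
  \sum_(E in bounded_graphs n R)
    ([&& x != y, [set x; y]%SET \notin E, degree E x < R & degree E y < R]%N)%:R * h E.
Proof.
set e := [set x; y]%SET.
rewrite (reindex_inj (inv_inj (edge_toggleK e))) big_mkcond [RHS]big_mkcond /=.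
apply: eq_bigr => E _; rewrite edge_toggleK in_edge_toggle eqxx.
case: (boolP (e \in E)) => eE /=; first by rewrite !andbF !mul0r; do 2 case: ifP.
case: (boolP (E \in _)) => GE; first by rewrite bounded_toggleE //; case: ifP; rewrite ?mul0r.
(* Here [E] arises from a bounded graph by deleting [e], so it is bounded itself, a
   contradiction. *)
case: ifPn => // GT; case/negP: GE.
have eT : e \in edge_toggle e E by rewrite in_edge_toggle (negbTE eE) eqxx.
case/bounded_graphsP: GT => gT dT; apply/bounded_graphsP.
rewrite -(edge_toggleK e E); split.
  by rewrite is_graph_toggle // cards2 (graph_edge_neq gT eT).
by move=> v; apply: leq_trans (dT v); rewrite -(degree_toggle_in v eT) leq_addr.
Qed.

Lemma deficiency_toggle_in (K : realType) n R e (E : {set {set 'I_n}}) :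
  e \in E -> deficiency K R (edge_toggle e E) = deficiency K R E + 2.
Proof.
by move=> eE; rewrite /deficiency -(card_toggle_in eE) mulnDr natrD; ring.
Qed.

(** The first double count: sum the toggle bijection over all ordered pairs. R n - d is the number
    of ordered adjacent pairs, and deleting an edge raises d by 2. *)
Lemma sum_remove_edge (K : realType) n R (h : K -> K) :
  \sum_(E in bounded_graphs n R)
     h (deficiency K R E + 2) * ((R * n)%:R - deficiency K R E) =
  \sum_(E in bounded_graphs n R) h (deficiency K R E) * addable_pairs K R E.
Proof.
have -> : \sum_(E in bounded_graphs n R) h (deficiency K R E) * addable_pairs K R E =
  \sum_x \sum_y \sum_(E in bounded_graphs n R)
    ([&& x != y, [set x; y]%SET \notin E, degree E x < R & degree E y < R]%N)%:R * h (deficiency K R E).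
  rewrite /addable_pairs; under eq_bigr do rewrite mulr_sumr.
  rewrite exchange_big; apply: eq_bigr => x _ /=.
  under eq_bigr do rewrite mulr_sumr.
  by rewrite exchange_big; apply: eq_bigr => y _ /=; apply: eq_bigr => E _; rewrite mulrC.
under [RHS]eq_bigr do under eq_bigr do rewrite -sum_toggle.
under [RHS]eq_bigr do rewrite exchange_big.
rewrite exchange_big; apply: eq_bigr => E /bounded_graphsP[gE _] /=.
have -> : (R * n)%:R - deficiency K R E = \sum_x \sum_y ([set x; y]%SET \in E)%:R.
  under eq_bigr do rewrite sum_edges_at //.
  by rewrite -natr_sum handshake // /deficiency; ring.
rewrite mulr_sumr; apply: eq_bigr => x _; rewrite mulr_sumr; apply: eq_bigr => y _.
case: (boolP (_ \in _)) => eE; last by rewrite mulr0 mul0r.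
by rewrite deficiency_toggle_in // mulr1 mul1r.
Qed.

(** * Comparing addable pairs, deficiency and numbers of deficient vertices *)

Lemma natr_num_deficient (K : realType) n R j (E : {set {set 'I_n}}) :
  (num_deficient R j E)%:R = \sum_v (degree E v + j <= R)%N%:R :> K.
Proof. exact: natr_card. Qed.

Lemma addable_pairs_le (K : realType) n R (E : {set {set 'I_n}}) :
  addable_pairs K R E <= (num_deficient R 1 E)%:R ^+ 2.
Proof.
rewrite expr2 !natr_num_deficient mulr_suml; apply: ler_sum => x _.
rewrite mulr_sumr; apply: ler_sum => y _; rewrite -natrM ler_nat !addn1.
by do 2 case: ltnP => _; rewrite ?andbF ?andbT //=; case: (_ && _).
Qed.

(** Each deficient vertex x excludes at most R + 1 partners: itself and its neighbours. *)
Lemma addable_pairs_ge (K : realType) n R (E : {set {set 'I_n}}) :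
  E \in bounded_graphs n R ->
  (num_deficient R 1 E)%:R ^+ 2 - (R%:R + 1) * (num_deficient R 1 E)%:R
    <= addable_pairs K R E.
Proof.
move=> /bounded_graphsP[gE dE]; rewrite expr2 -mulrBl mulrC {1}natr_num_deficient mulr_suml.
apply: ler_sum => x _; rewrite addn1.
have -> : (num_deficient R 1 E)%:R = \sum_y (degree E y < R)%N%:R :> K.
  by rewrite natr_num_deficient; apply: eq_bigr => y _; rewrite addn1.
apply: (@le_trans _ _ ((degree E x < R)%N%:R *
  \sum_y ((degree E y < R)%N%:R - (y == x)%:R - ([set x; y]%SET \in E)%:R))).
  apply: ler_wpM2l; first by rewrite ler0n.
  rewrite !sumrB sum_edges_at // -[\sum_(y : _) (y == x)%:R]natr_card.
  have -> : [set y | y == x]%SET = [set x]%SET by apply/setP => y; rewrite !inE.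
  by rewrite cards1; have := dE x; rewrite -(ler_nat K); lra.
rewrite mulr_sumr; apply: ler_sum => y _; rewrite (eq_sym y x).
by case: (degree E x < R)%N; case: (degree E y < R)%N; case: (x == y);
  case: (_ \in E); rewrite /= ?mul0r ?mul1r; lra.
Qed.

(** Compared vertex by vertex: a deficiency of 1 is counted exactly, and a larger one is at most R
    <= 1 + R. *)
Lemma deficiency_le (K : realType) n R (E : {set {set 'I_n}}) :
  E \in bounded_graphs n R ->
  deficiency K R E <= (num_deficient R 1 E)%:R + R%:R * (num_deficient R 2 E)%:R.
Proof.
move=> /bounded_graphsP[gE dE]; rewrite deficiency_sum // !natr_num_deficient.
rewrite mulr_sumr -big_split /=; apply: ler_sum => v _.
rewrite lerBlDr -!natrM -!natrD ler_nat.
by have := dE v; case: (leqP (degree E v + 1) R); case: (leqP (degree E v + 2) R) => /=; lia.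
Qed.

Lemma deficiency_ge (K : realType) n R (E : {set {set 'I_n}}) :
  E \in bounded_graphs n R ->
  (num_deficient R 1 E)%:R + (num_deficient R 2 E)%:R <= deficiency K R E.
Proof.
move=> /bounded_graphsP[gE dE]; rewrite deficiency_sum // !natr_num_deficient.
rewrite -big_split /=; apply: ler_sum => v _.
rewrite lerBrDr -!natrD ler_nat.
by have := dE v; case: (leqP (degree E v + 1) R); case: (leqP (degree E v + 2) R) => /=; lia.
Qed.

Lemma deficiency_le_mul (K : realType) n R (E : {set {set 'I_n}}) :
  E \in bounded_graphs n R ->
  deficiency K R E <= R%:R * (num_deficient R 1 E)%:R.
Proof.
move=> /bounded_graphsP[gE dE]; rewrite deficiency_sum // !natr_num_deficient.
rewrite mulr_sumr; apply: ler_sum => v _.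
rewrite lerBlDr -!natrM -!natrD ler_nat.
by have := dE v; case: (leqP (degree E v + 1) R) => /=; lia.
Qed.

Lemma leq_num_deficient n R i j (E : {set {set 'I_n}}) :
  (i <= j)%N -> (num_deficient R j E <= num_deficient R i E)%N.
Proof.
move=> ij; apply/subset_leq_card/subsetP => v; rewrite !inE.
by apply: leq_trans; rewrite leq_add2l.
Qed.

Lemma num_degreeE n R j (E : {set {set 'I_n}}) : (j <= R)%N ->
  (num_degree E (R - j) + num_deficient R j.+1 E = num_deficient R j E)%N.
Proof.
move=> jR; rewrite /num_degree /num_deficient -!sum1dep_card.
rewrite big_mkcond [X in (_ + X)%N]big_mkcond [RHS]big_mkcond -big_split /=.
apply: eq_bigr => v _.
case: eqVneq; case: (leqP (degree E v + j.+1) R); case: (leqP (degree E v + j) R) => /=; lia.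
Qed.

(** * Switchings: moving one end of an edge from a full vertex to a deficient one *)

(** When xy is an edge and vy is not, this replaces xy by vy. As a composite of toggles it is
    defined on all edge sets, and exchanging v and x inverts it. *)
Definition edge_switch n (v x y : 'I_n) (E : {set {set 'I_n}}) :=
  edge_toggle [set v; y]%SET (edge_toggle [set x; y]%SET E).

Lemma edge_switchK n (v x y : 'I_n) :
  cancel (edge_switch v x y) (edge_switch x v y).
Proof. by move=> E; rewrite /edge_switch !edge_toggleK. Qed.

(* A switch raises the degree of [v] by one, so the condition [T] on its old
   degree becomes [pred_shift T] on the new one. *)
Definition pred_shift (T : pred nat) : pred nat :=
  fun d => if d is d'.+1 then T d' else false.

Definition switchable n R (T : pred nat) (E : {set {set 'I_n}}) (v x y : 'I_n) :=
  [&& [set x; y]%SET \in E, degree E x == R, T (degree E v), y != v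
    & [set v; y]%SET \notin E].

(** Describes the images of [switchable] triples: x now misses one edge, v has gained one, and the
    last three conditions let the reverse switch produce a simple graph. *)
Definition unswitchable n R (T : pred nat) (E : {set {set 'I_n}}) (v x y : 'I_n) :=
  [&& [set v; y]%SET \in E, (degree E x).+1 == R, pred_shift T (degree E v),
      x != v, y != x & [set x; y]%SET \notin E].

Section Switching.
Variables (n R : nat).
Implicit Types (E : {set {set 'I_n}}) (v x y w : 'I_n) (T : pred nat).

Lemma switch_edge_neq E v x y : [set x; y]%SET \in E -> [set v; y]%SET \notin E ->
  ([set x; y]%SET == [set v; y]%SET) = false.
Proof. by move=> xyE vyE; apply/eqP => xyv; rewrite xyv (negbTE vyE) in xyE. Qed.

(** Written additively to stay in the naturals; y lies in both edges, so its degree does not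
    change. *)
Lemma degree_switch E v x y w : [set x; y]%SET \in E -> [set v; y]%SET \notin E ->
  (degree (edge_switch v x y E) w + (w \in [set x; y]%SET) =
   degree E w + (w \in [set v; y]%SET))%N.
Proof.
move=> xyE vyE; rewrite /edge_switch degree_toggle_notin.
  by rewrite addnAC degree_toggle_in.
by rewrite in_edge_toggle (negbTE vyE) eq_sym (switch_edge_neq xyE vyE).
Qed.

Lemma mem_switch E v x y : [set x; y]%SET \in E -> [set v; y]%SET \notin E ->
  ([set v; y]%SET \in edge_switch v x y E) * ([set x; y]%SET \notin edge_switch v x y E).
Proof.
move=> xyE vyE; have := switch_edge_neq xyE vyE; rewrite /edge_switch !in_edge_toggle !eqxx.
by rewrite (negbTE vyE) xyE [[set v; y]%SET == _]eq_sym => ->.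
Qed.

Lemma card_switch E v x y : [set x; y]%SET \in E -> [set v; y]%SET \notin E ->
  #|edge_switch v x y E| = #|E|.
Proof.
move=> xyE vyE; rewrite /edge_switch card_toggle_notin ?card_toggle_in //.
by rewrite in_edge_toggle (negbTE vyE) eq_sym (switch_edge_neq xyE vyE).
Qed.

Lemma bounded_switch E v x y : E \in bounded_graphs n R ->
  [set x; y]%SET \in E -> [set v; y]%SET \notin E -> y != v ->
  (degree E v < R)%N -> edge_switch v x y E \in bounded_graphs n R.
Proof.
move=> /bounded_graphsP[gE dE] xyE vyE yv dv; have xy := graph_edge_neq gE xyE.
apply/bounded_graphsP; split.
  by rewrite /edge_switch !is_graph_toggle // cards2 ?xy // eq_sym yv.
move=> w; have := degree_switch w xyE vyE; have := dE w; rewrite !inE.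
by case: eqVneq => _; case: (eqVneq w v) => [->|_]; case: eqVneq => _ /=; lia.
Qed.

(** Since [T] only holds below R while x has degree R, the vertices v and x differ. *)
Lemma switchableP T E v x y : (forall d, T d -> (d < R)%N) ->
  E \in bounded_graphs n R -> switchable R T E v x y ->
  edge_switch v x y E \in bounded_graphs n R /\
  unswitchable R T (edge_switch v x y E) v x y.
Proof.
move=> TR GE /and5P[xyE /eqP dx Tv yv vyE].
split; first by apply: bounded_switch => //; exact: TR.
have [gE _] := elimT (bounded_graphsP _ _) GE; have xy := graph_edge_neq gE xyE.
have vx : (v == x) = false.
  by apply/eqP => vx; have := TR _ Tv; rewrite vx dx ltnn.
have := degree_switch x xyE vyE; have := degree_switch v xyE vyE.
rewrite !inE !eqxx /= (eq_sym v y) (negbTE yv) (eq_sym x v) vx (negbTE xy) /=.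
rewrite addn0 !addn1 dx addn0 => dv' dx'; rewrite /unswitchable dx' dv' /= Tv eqxx.
by rewrite eq_sym vx (eq_sym y x) xy !mem_switch.
Qed.

Lemma unswitchableP T E v x y :
  E \in bounded_graphs n R -> unswitchable R T E v x y ->
  edge_switch x v y E \in bounded_graphs n R /\
  switchable R T (edge_switch x v y E) v x y.
Proof.
move=> GE /and5P[vyE /eqP dx Tv xv /andP[yx xyE]].
split; first by apply: bounded_switch => //; rewrite -dx.
have [gE _] := elimT (bounded_graphsP _ _) GE; have vy := graph_edge_neq gE vyE.
have := degree_switch x vyE xyE; have := degree_switch v vyE xyE.
rewrite !inE !eqxx /= (eq_sym v x) (negbTE xv) (negbTE vy) (eq_sym x y) (negbTE yx) /=.
rewrite !addn0 !addn1 dx => dv' dx'; rewrite -dv' /= in Tv.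
by rewrite /switchable dx' Tv eqxx (eq_sym y v) vy !mem_switch.
Qed.

Variable K : realType.

Definition switchings T E : K := \sum_v \sum_x \sum_y (switchable R T E v x y)%:R.
Definition unswitchings T E : K := \sum_v \sum_x \sum_y (unswitchable R T E v x y)%:R.

(** The second double count, by reindexing separately for each triple (v, x, y). Two weights are
    allowed because the Poisson recursion tracks a statistic that changes under the switch. *)
Lemma sum_switch T (w w' : {set {set 'I_n}} -> K) : (forall d, T d -> (d < R)%N) ->
  (forall E v x y, E \in bounded_graphs n R -> switchable R T E v x y ->
     w E = w' (edge_switch v x y E)) ->
  \sum_(E in bounded_graphs n R) w E * switchings T E =
  \sum_(E in bounded_graphs n R) w' E * unswitchings T E.
Proof.
move=> TR ww'.
have sw (u : {set {set 'I_n}} -> K) (P : {set {set 'I_n}} -> 'I_n -> 'I_n -> 'I_n -> bool) :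
    \sum_(E in bounded_graphs n R) u E * (\sum_v \sum_x \sum_y (P E v x y)%:R) =
    \sum_v \sum_x \sum_y \sum_(E in bounded_graphs n R) u E * (P E v x y)%:R.
  under eq_bigr do rewrite mulr_sumr.
  rewrite exchange_big; apply: eq_bigr => v _ /=.
  under eq_bigr do rewrite mulr_sumr.
  rewrite exchange_big; apply: eq_bigr => x _ /=.
  under eq_bigr do rewrite mulr_sumr.
  by rewrite exchange_big.
rewrite !sw; apply: eq_bigr => v _; apply: eq_bigr => x _; apply: eq_bigr => y _.
rewrite (reindex_inj (can_inj (edge_switchK x v y))) big_mkcond [RHS]big_mkcond /=.
apply: eq_bigr => E _; set E' := edge_switch x v y E.
have E'K : edge_switch v x y E' = E by exact: edge_switchK.
case: (boolP ((E \in bounded_graphs n R) && unswitchable R T E v x y)).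
  move=> /andP[GE BE]; have [GE' FE'] := unswitchableP GE BE.
  by rewrite GE GE' BE FE' (ww' _ v x y) // E'K.
move=> nGB; have -> : (if E \in bounded_graphs n R then w' E * (unswitchable R T E v x y)%:R else 0) = 0.
  by move: nGB; case: ifP => // _ /= /negbTE ->; rewrite mulr0.
case: ifP => // GE'; case: (boolP (switchable _ _ _ _ _ _)) => FE'; last by rewrite mulr0.
by have [] := switchableP TR GE' FE'; rewrite E'K => GE BE; rewrite GE BE in nGB.
Qed.

Lemma sum_natr_eq v : \sum_y (y == v)%:R = 1 :> K.
Proof.
rewrite -natr_card; have -> : [set y | y == v]%SET = [set v]%SET.
  by apply/setP => y; rewrite !inE.
by rewrite cards1.
Qed.

(** The left side counts walks v, y, x of length two. *)
Lemma sum_neighbour_degrees_le E v : E \in bounded_graphs n R ->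
  \sum_x \sum_y ([set v; y]%SET \in E)%:R * ([set x; y]%SET \in E)%:R <= R%:R ^+ 2 :> K.
Proof.
move=> /bounded_graphsP[gE dE]; rewrite exchange_big /=.
apply: (@le_trans _ _ (\sum_y ([set v; y]%SET \in E)%:R * R%:R)).
  apply: ler_sum => y _; rewrite -mulr_sumr; apply: ler_wpM2l; first by rewrite ler0n.
  under eq_bigr do rewrite finset.setUC.
  by rewrite sum_edges_at // ler_nat.
by rewrite -mulr_suml sum_edges_at // expr2 ler_wpM2r ?ler0n ?ler_nat.
Qed.

(** For each v, the full vertices offer R edges each; the triples lost are at most R with y = v and
    at most R^2 with y adjacent to v. *)
Lemma switchings_ge T E : E \in bounded_graphs n R ->
  (R%:R * n%:R - R%:R * (num_deficient R 1 E)%:R - R%:R * (R%:R + 1)) *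
    #|[set v | T (degree E v)]|%:R <= switchings T E.
Proof.
move=> GE; have [gE dE] := elimT (bounded_graphsP _ _) GE.
rewrite (natr_card K (fun v => T (degree E v))) mulr_sumr; apply: ler_sum => v _.
apply: (@le_trans _ _ ((T (degree E v))%:R * \sum_x \sum_y
  ((degree E x == R)%:R * ([set x; y]%SET \in E)%:R
   - ([set x; y]%SET \in E)%:R * (y == v)%:R
   - ([set v; y]%SET \in E)%:R * ([set x; y]%SET \in E)%:R))); last first.
  rewrite mulr_sumr; apply: ler_sum => x _; rewrite mulr_sumr; apply: ler_sum => y _.
  rewrite /switchable; case: (T _) => /=; rewrite ?mul0r ?mul1r ?ler0n //.
  by case: (_ == R); case: (y == v); case: ([set x; y]%SET \in E);
    case: ([set v; y]%SET \in E); rewrite /= ?mulr0 ?mul0r ?mulr1; lra.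
rewrite mulrC; apply: ler_wpM2l; first by rewrite ler0n.
have H1 := sum_neighbour_degrees_le v GE.
have H2 : \sum_x \sum_y ([set x; y]%SET \in E)%:R * (y == v)%:R <= R%:R :> K.
  rewrite exchange_big /=; under eq_bigr do rewrite -mulr_suml.
  under eq_bigr do under eq_bigr do rewrite finset.setUC.
  under eq_bigr do rewrite sum_edges_at //.
  apply: (@le_trans _ _ (\sum_y R%:R * (y == v)%:R)).
    by apply: ler_sum => y _; rewrite ler_wpM2r ?ler0n ?ler_nat.
  by rewrite -mulr_sumr sum_natr_eq mulr1.
have H3 : \sum_x \sum_y (degree E x == R)%:R * ([set x; y]%SET \in E)%:R =
    R%:R * n%:R - R%:R * (num_deficient R 1 E)%:R :> K.
  under eq_bigr do rewrite -mulr_sumr sum_edges_at //.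
  rewrite natr_num_deficient -mulrBr -[X in X%:R - _]card_ord -sum1_card natr_sum -sumrB mulr_sumr.
  apply: eq_bigr => x _; have := dE x; rewrite addn1.
  by case: ltngtP => //; rewrite ?subrr ?subr0 ?mul0r ?mulr0 // => ->; rewrite mul1r mulr1.
under eq_bigr do rewrite !sumrB.
by rewrite !sumrB H3; lra.
Qed.

Lemma switchings_le T E : E \in bounded_graphs n R ->
  switchings T E <= R%:R * n%:R * #|[set v | T (degree E v)]|%:R.
Proof.
move=> GE; have [gE dE] := elimT (bounded_graphsP _ _) GE.
rewrite (natr_card K (fun v => T (degree E v))) mulr_sumr; apply: ler_sum => v _.
apply: (@le_trans _ _ (\sum_(x : 'I_n) R%:R * (T (degree E v))%:R)); last first.
  by rewrite sumr_const card_ord -[leLHS]mulr_natr mulrAC lexx.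
apply: ler_sum => x _.
apply: (@le_trans _ _ ((degree E x)%:R * (T (degree E v))%:R)); last first.
  by rewrite ler_wpM2r ?ler0n ?ler_nat.
rewrite -sum_edges_at // mulr_suml; apply: ler_sum => y _; rewrite /switchable.
by case: (T _); case: (_ \in E) => /=; rewrite ?mul0r ?mulr0 ?mul1r ?andbF // lern1 leq_b1.
Qed.

Lemma unswitchings_le T E : E \in bounded_graphs n R ->
  unswitchings T E <= (\sum_x ((degree E x).+1 == R)%:R) *
    \sum_v (pred_shift T (degree E v))%:R * (degree E v)%:R.
Proof.
move=> GE; have [gE dE] := elimT (bounded_graphsP _ _) GE.
rewrite mulr_sumr; apply: ler_sum => v _; rewrite mulr_suml; apply: ler_sum => x _.
rewrite -sum_edges_at // mulrA mulr_sumr; apply: ler_sum => y _; rewrite /unswitchable.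
by case: (_ == R); case: (_ \in E); case: (pred_shift _ _);
  rewrite /= ?(mul0r, mulr0, mul1r) ?andbF ?mul0r ?mulr0 ?lern1 ?leq_b1.
Qed.

(** For each v, the triples lost are at most R with x = v, R with y = x, and R^2 with x adjacent to
    y. *)
Lemma unswitchings_ge T E : E \in bounded_graphs n R ->
  \sum_v (pred_shift T (degree E v))%:R *
    ((\sum_x ((degree E x).+1 == R)%:R) * (degree E v)%:R - R%:R * (R%:R + 2))
  <= unswitchings T E.
Proof.
move=> GE; have [gE dE] := elimT (bounded_graphsP _ _) GE.
apply: ler_sum => v _.
apply: (@le_trans _ _ ((pred_shift T (degree E v))%:R * \sum_x \sum_y
  (((degree E x).+1 == R)%:R * ([set v; y]%SET \in E)%:R
   - (x == v)%:R * ([set v; y]%SET \in E)%:R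
   - ([set v; y]%SET \in E)%:R * (y == x)%:R
   - ([set v; y]%SET \in E)%:R * ([set x; y]%SET \in E)%:R))); last first.
  rewrite mulr_sumr; apply: ler_sum => x _; rewrite mulr_sumr; apply: ler_sum => y _.
  rewrite /unswitchable; case: (pred_shift _ _) => /=; rewrite ?mul0r ?mul1r ?ler0n //.
  by case: (_ == R); case: (x == v); case: (y == x); case: ([set x; y]%SET \in E);
    case: ([set v; y]%SET \in E); rewrite /= ?mulr0 ?mul0r ?mulr1; lra.
apply: ler_wpM2l; first by rewrite ler0n.
have H1 := sum_neighbour_degrees_le v GE.
have dv : (degree E v)%:R <= R%:R :> K by rewrite ler_nat.
have H2 : \sum_x \sum_y (x == v)%:R * ([set v; y]%SET \in E)%:R <= R%:R :> K.
  under eq_bigr do rewrite -mulr_sumr sum_edges_at //.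
  by rewrite -mulr_suml sum_natr_eq mul1r.
have H3 : \sum_x \sum_y ([set v; y]%SET \in E)%:R * (y == x)%:R <= R%:R :> K.
  rewrite exchange_big /=; under eq_bigr do under eq_bigr do rewrite eq_sym.
  by under eq_bigr do rewrite -mulr_sumr sum_natr_eq mulr1; rewrite sum_edges_at.
have H4 : \sum_x \sum_y ((degree E x).+1 == R)%:R * ([set v; y]%SET \in E)%:R =
    (\sum_x ((degree E x).+1 == R)%:R) * (degree E v)%:R :> K.
  by under eq_bigr do rewrite -mulr_sumr sum_edges_at //; rewrite -mulr_suml.
under [leRHS]eq_bigr do rewrite !sumrB.
by rewrite !sumrB H4; lra.
Qed.

End Switching.

(** * Expectation over a uniform bounded graph *)

Definition mean (K : realType) (n R : nat) (f : {set {set 'I_n}} -> K) : K :=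
  (\sum_(E in bounded_graphs n R) f E) / #|bounded_graphs n R|%:R.

Section Mean.
Variables (K : realType) (n R : nat).
Implicit Types f g : {set {set 'I_n}} -> K.

Lemma card_bounded_graphs_gt0 : 0 < #|bounded_graphs n R|%:R :> K.
Proof.
rewrite ltr0n; apply/card_gt0P; exists finset.set0; apply/bounded_graphsP; split.
  by apply/forall_inP => e; rewrite inE.
move=> v; rewrite /degree (_ : [set e in _ | _]%SET = finset.set0) ?cards0 //.
by apply/setP => e; rewrite !inE.
Qed.

Lemma proportionE (P : {set {set 'I_n}} -> bool) :
  proportion K R P = mean R (fun E => (P E)%:R).
Proof.
congr (_ / _); rewrite -sum1dep_card natr_sum big_mkcondr /=.
by apply: eq_bigr => E _; case: (P E).
Qed.

Lemma mean_le f g : (forall E, E \in bounded_graphs n R -> f E <= g E) ->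
  mean R f <= mean R g.
Proof.
move=> fg; rewrite ler_wpM2r ?invr_ge0 ?ler0n //.
by apply: ler_sum => E; exact: fg.
Qed.

Lemma mean_eq f g : (forall E, E \in bounded_graphs n R -> f E = g E) ->
  mean R f = mean R g.
Proof. by move=> fg; rewrite /mean (eq_bigr g). Qed.

Lemma meanD f g : mean R (fun E => f E + g E) = mean R f + mean R g.
Proof. by rewrite /mean big_split mulrDl. Qed.

Lemma meanN f : mean R (fun E => - f E) = - mean R f.
Proof. by rewrite /mean sumrN mulNr. Qed.

Lemma meanZ (c : K) f : mean R (fun E => c * f E) = c * mean R f.
Proof. by rewrite /mean -mulr_sumr mulrA. Qed.

Lemma mean_cst (c : K) : mean R (fun _ : {set {set 'I_n}} => c) = c.
Proof.
rewrite /mean sumr_const -[c *+ _]mulr_natr mulfK //.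
by rewrite gt_eqF ?card_bounded_graphs_gt0.
Qed.

Lemma mean_sum (I : finType) (F : I -> {set {set 'I_n}} -> K) :
  mean R (fun E => \sum_i F i E) = \sum_i mean R (F i).
Proof. by rewrite /mean exchange_big mulr_suml. Qed.

Lemma mean_ge0 f : (forall E, E \in bounded_graphs n R -> 0 <= f E) -> 0 <= mean R f.
Proof. by move=> f0; rewrite -(mean_cst 0); exact: mean_le. Qed.

Lemma mean_norm f : `|mean R f| <= mean R (fun E => `|f E|).
Proof.
rewrite /mean normrM [`|_^-1|]ger0_norm ?invr_ge0 ?ler0n //.
by rewrite ler_wpM2r ?invr_ge0 ?ler0n // ler_norm_sum.
Qed.

End Mean.

(** * Moments of the deficiency and of the numbers of very deficient vertices *)

Section Moments.
Variables (K : realType) (R : nat).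
Hypothesis hR : (2 <= R)%N.

Local Notation d E := (deficiency K R E).
Local Notation q j E := ((num_deficient R j E)%:R : K).
Local Notation a E := ((num_degree E (R - 1))%:R : K).
Local Notation r := (R%:R : K).

Lemma natr_ge2 : 2 <= r. Proof. by rewrite ler_nat. Qed.

Section FixedOrder.
Variable n : nat.
Implicit Types E : {set {set 'I_n}}.

Lemma num_deficient_ge0 j E : 0 <= q j E. Proof. exact: ler0n. Qed.

Lemma num_deficient_anti i j E : (i <= j)%N -> q j E <= q i E.
Proof. by move=> ij; rewrite ler_nat leq_num_deficient. Qed.

Lemma num_deficient_le_deficiency E : E \in bounded_graphs n R -> q 1 E <= d E.
Proof. by move=> GE; have := deficiency_ge K GE; have := num_deficient_ge0 2 E; lra. Qed.

Lemma deficiency_ge0 E : E \in bounded_graphs n R -> 0 <= d E.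
Proof. by move=> GE; exact: le_trans (num_deficient_ge0 1 E) (num_deficient_le_deficiency GE). Qed.

Lemma num_degree_predE E : a E = q 1 E - q 2 E.
Proof. by rewrite -(@num_degreeE n R 1) ?natrD ?addrK // (leq_trans _ hR). Qed.

Lemma sum_degree_pred E : \sum_x ((degree E x).+1 == R)%:R = a E.
Proof.
rewrite /num_degree natr_card; apply: eq_bigr => x _; congr (_%:R); apply: congr1.
by apply/eqP/eqP; lia.
Qed.

Lemma natr_le_sqr (m : nat) : m%:R <= m%:R ^+ 2 :> K.
Proof. by rewrite -natrX ler_nat; case: m => // m; rewrite leq_pmulr. Qed.

Lemma mean_remove_edge (h : K -> K) :
  mean R (fun E : {set {set 'I_n}} => h (d E + 2) * (r * n%:R - d E)) =
  mean R (fun E : {set {set 'I_n}} => h (d E) * addable_pairs K R E).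
Proof. by rewrite /mean -sum_remove_edge natrM. Qed.

Lemma mean_switch (T : pred nat) (w w' : {set {set 'I_n}} -> K) :
  (forall e, T e -> (e < R)%N) ->
  (forall E v x y, E \in bounded_graphs n R -> switchable R T E v x y ->
     w E = w' (edge_switch v x y E)) ->
  mean R (fun E => w E * switchings R K T E) =
  mean R (fun E => w' E * unswitchings R K T E).
Proof. by move=> TR ww'; rewrite /mean (sum_switch TR ww'). Qed.

Lemma deficiency_switch E v x y (T : pred nat) :
  switchable R T E v x y -> d (edge_switch v x y E) = d E.
Proof. by case/and5P => xyE _ _ _ vyE; rewrite /deficiency card_switch. Qed.

(** A vertex of deficiency at least j + 1 still has deficiency at least j after gaining an edge; x
    ranges over the a <= q_1 vertices of degree R - 1. *)
Lemma unswitchings_deficient_le j E : E \in bounded_graphs n R ->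
  unswitchings R K (fun e => e + j.+1 <= R)%N E <= r * (q 1 E * q j E).
Proof.
move=> GE; apply: le_trans (unswitchings_le K _ GE) _; rewrite sum_degree_pred.
have H : \sum_v (pred_shift (fun e => (e + j.+1 <= R)%N) (degree E v))%:R * (degree E v)%:R
    <= r * q j E.
  rewrite natr_num_deficient mulr_sumr; apply: ler_sum => v _.
  case: (degree E v) => [|e] /=; first by rewrite mul0r mulr_ge0 ?ler0n.
  rewrite addSnnS; case: leqP => ejR /=; last by rewrite mul0r mulr0.
  by rewrite mul1r mulr1 ler_nat; lia.
apply: (@le_trans _ _ (a E * (r * q j E))); first by rewrite ler_wpM2l ?ler0n.
rewrite mulrCA ler_wpM2l ?ler0n // ler_wpM2r ?ler0n // num_degree_predE.
by have := num_deficient_ge0 2 E; lra.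
Qed.

(** A switch preserves d, so d^i may weight both sides. About R n switchings leave each vertex of
    deficiency above j, against at most R q_1 q_j reverse ones: q_{j+1} is smaller than q_j by a
    factor of order d / n. *)
Lemma mean_deficient_step i j : (0 < j)%N ->
  n%:R * mean R (fun E : {set {set 'I_n}} => d E ^+ i * q j.+1 E) <=
  (r + 3) * mean R (fun E : {set {set 'I_n}} => d E ^+ i.+1 * q j E).
Proof.
move=> j0; have r2 := natr_ge2.
have sw : mean R (fun E => d E ^+ i * switchings R K (fun e => e + j.+1 <= R)%N E) =
    mean R (fun E : {set {set 'I_n}} => d E ^+ i * unswitchings R K (fun e => e + j.+1 <= R)%N E).
  apply: mean_switch => [e|E v x y _ sE]; last by rewrite (deficiency_switch sE).
  by apply: leq_trans; rewrite addnS ltnS leq_addr.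
rewrite -(ler_pM2l (_ : 0 < r)); last by lra.
rewrite -!meanZ -subr_ge0.
have -> : 0 = mean R (fun E : {set {set 'I_n}} => d E ^+ i * unswitchings R K (fun e => e + j.+1 <= R)%N E)
    - mean R (fun E => d E ^+ i * switchings R K (fun e => e + j.+1 <= R)%N E).
  by rewrite sw subrr.
rewrite -!meanN -!meanD; apply: mean_le => E GE; rewrite exprS.
have di : 0 <= d E ^+ i by rewrite exprn_ge0 // deficiency_ge0.
have H1 := unswitchings_deficient_le j GE.
have H2 := switchings_ge K (fun e => e + j.+1 <= R)%N GE; rewrite -/(num_deficient R j.+1 E) in H2.
have q1 := num_deficient_le_deficiency GE.
have qj := num_deficient_anti E (leqnSn j); have qj1 := num_deficient_anti E j0.
have := num_deficient_ge0 j.+1 E; have := num_deficient_ge0 1 E.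
have := natr_le_sqr (num_deficient R j.+1 E).
move: H1 H2 q1 qj qj1 di; set U := unswitchings _ _ _ _; set S := switchings _ _ _ _.
move: (d E ^+ i) (d E) (q 1 E) (q j E) (q j.+1 E) (n%:R : K) => D dE s Q Q' N.
move=> H1 H2 sd Q'Q Qs D0 Q'2 s0 Q'0.
(* All error terms are absorbed into d q_j, and R + 3 collects 1 + 1 + (R + 1). For [A3], a natural
   number is at most its square. *)
have A1 : s * Q' <= dE * Q by apply: ler_pM.
have A2 : s * Q <= dE * Q by apply: ler_wpM2r => //; lra.
have A3 : Q' <= dE * Q by apply: le_trans Q'2 _; apply: ler_pM => //; lra.
have A4 : r * (s * Q') <= r * (dE * Q) by rewrite ler_pM2l //; lra.
have A5 : r * (s * Q) <= r * (dE * Q) by rewrite ler_pM2l //; lra.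
have A6 : r * (r + 1) * Q' <= r * (r + 1) * (dE * Q).
  by rewrite ler_wpM2l //; apply: mulr_ge0; lra.
have A7 : U - S <= r * (r + 3) * (dE * Q) - r * N * Q' by lra.
have := ler_wpM2l D0 A7; lra.
Qed.

(** Take h(x) = x^2 in the first double count: d^4 is at most of order d^2 (P + 1), and E[d^2 P] is
    at most R n E[(d + 2)^2], so the fourth moment is controlled by n times the second. *)
Lemma mean_fourth_le : (0 < n)%N ->
  mean R (fun E : {set {set 'I_n}} => d E ^+ 4) <=
  ((4 * r ^+ 3 + r ^+ 2 * (r + 1) ^+ 2) ^+ 2 + 32 * r ^+ 3) * n%:R ^+ 2.
Proof.
move=> n0; have r2 := natr_ge2; set N := n%:R; have N1 : 1 <= N by rewrite ler1n.
have idt := mean_remove_edge (fun x => x ^+ 2).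
set K0 := 4 * r ^+ 3 + r ^+ 2 * (r + 1) ^+ 2.
set m4 := mean _ _.
set m2 := mean R (fun E : {set {set 'I_n}} => d E ^+ 2).
have H1 : m4 <= 2 * r ^+ 2 * mean R (fun E : {set {set 'I_n}} => d E ^+ 2 * addable_pairs K R E)
   + r ^+ 2 * (r + 1) ^+ 2 * m2.
  rewrite -!meanZ -meanD; apply: mean_le => E GE.
  have dR := deficiency_le_mul K GE; have P := addable_pairs_ge K GE; have d0 := deficiency_ge0 GE.
  move: dR P d0 (num_deficient_ge0 1 E); move: (d E) (q 1 E) (addable_pairs K R E) => x s P xs Ps x0 s0.
  have A1 : x ^+ 2 <= r ^+ 2 * s ^+ 2 by rewrite -exprMn ler_pXn2r // nnegrE mulr_ge0 ?ler0n.
  have A2 : s ^+ 2 <= 2 * P + (r + 1) ^+ 2.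
    have := sqr_ge0 (s - (r + 1)); rewrite sqrrB; lra.
  have A3 : r ^+ 2 * s ^+ 2 <= r ^+ 2 * (2 * P + (r + 1) ^+ 2) by rewrite ler_wpM2l ?sqr_ge0.
  have := ler_wpM2l (sqr_ge0 x) (le_trans A1 A3).
  by rewrite -exprD; lra.
have H2 : mean R (fun E : {set {set 'I_n}} => (d E + 2) ^+ 2 * (r * N - d E)) <=
    r * N * (2 * m2 + 8).
  have -> : r * N * (2 * m2 + 8) =
      mean R (fun E : {set {set 'I_n}} => 2 * r * N * d E ^+ 2 + 8 * r * N).
    by rewrite meanD mean_cst meanZ /m2; ring.
  apply: mean_le => E GE; move: (deficiency_ge0 GE); move: (d E) => x x0.
  have A1 : (x + 2) ^+ 2 <= 2 * x ^+ 2 + 8 by have := sqr_ge0 (x - 2); lra.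
  have A2 : r * N - x <= r * N by lra.
  have A3 : 0 <= r * N by apply: mulr_ge0; lra.
  have A4 := ler_wpM2l (sqr_ge0 (x + 2)) A2; have A5 := ler_wpM2r A3 A1; lra.
rewrite idt in H2.
(* By the arithmetic-geometric inequality the second moment costs only half of [m4], which moves to
   the left side. *)
have H3 : K0 * N * m2 <= m4 / 2 + K0 ^+ 2 * N ^+ 2 / 2.
  have -> : m4 / 2 + K0 ^+ 2 * N ^+ 2 / 2 =
      mean R (fun E : {set {set 'I_n}} => 1 / 2 * d E ^+ 4 + K0 ^+ 2 * N ^+ 2 / 2).
    by rewrite meanD mean_cst meanZ -/m4; field.
  rewrite /m2 -meanZ; apply: mean_le => E _; move: (d E) => x.
  have := sqr_ge0 (x ^+ 2 - K0 * N); lra.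
have m20 : 0 <= m2 by apply: mean_ge0 => E _; exact: sqr_ge0.
have r30 : 0 <= 2 * r ^+ 2 by apply: mulr_ge0 => //; exact: sqr_ge0.
have H4 := ler_wpM2l r30 H2.
have H5 : r ^+ 2 * (r + 1) ^+ 2 * m2 <= r ^+ 2 * (r + 1) ^+ 2 * m2 * N.
  by rewrite ler_peMr // mulr_ge0 // -exprMn sqr_ge0.
have H6 : 16 * r ^+ 3 * N <= 16 * r ^+ 3 * N ^+ 2.
  rewrite ler_wpM2l ?mulr_ge0 ?exprn_ge0 ?ler0n //.
  by rewrite expr2 ler_peMr // (le_trans ler01).
rewrite /K0 in H3 *; lra.
Qed.

Lemma mean_moment_le (u : K) j : 1 <= u -> u ^+ 4 = n%:R -> (j <= 4)%N ->
  mean R (fun E : {set {set 'I_n}} => d E ^+ j) <=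
  ((4 * r ^+ 3 + r ^+ 2 * (r + 1) ^+ 2) ^+ 2 + 32 * r ^+ 3 + 1) * u ^+ (2 * j).
Proof.
move=> u1 un j4; have u0 : 0 < u by lra.
have n0 : (0 < n)%N by rewrite -(ltr0n K) -un exprn_gt0.
have := mean_fourth_le n0; set M := (_ + 32 * _); rewrite -un.
have -> : u ^+ 4 = (u ^+ 2) ^+ 2 by rewrite -exprM.
rewrite exprM; have : 0 < u ^+ 2 by rewrite exprn_gt0.
move: (u ^+ 2) => v v0 H.
(* Rescale to x = d / u^2, the natural size of d, and use x^j <= x^4 + 1. *)
apply: (@le_trans _ _ (mean R (fun E : {set {set 'I_n}} =>
   v ^+ j / v ^+ 4 * d E ^+ 4 + v ^+ j))).
  apply: mean_le => E GE.
  have : 0 <= d E / v by rewrite divr_ge0 ?deficiency_ge0 // ltW.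
  have : d E = v * (d E / v) by rewrite mulrC divfK ?gt_eqF.
  move: (d E / v) => x -> x0; rewrite !exprMn.
  have -> : v ^+ j / v ^+ 4 * (v ^+ 4 * x ^+ 4) + v ^+ j = v ^+ j * (x ^+ 4 + 1).
    by field; rewrite gt_eqF.
  rewrite ler_wpM2l ?exprn_ge0 ?(ltW v0) //.
  case: (leP x 1) => x1.
    by apply: (@le_trans _ _ 1); rewrite ?exprn_ile1 // lerDr exprn_ge0.
  by apply: (@le_trans _ _ (x ^+ 4)); rewrite ?lerDl // ler_weXn2l // ltW.
rewrite meanD mean_cst meanZ [leRHS]mulrDl mul1r lerD2r.
apply: (@le_trans _ _ (v ^+ j / v ^+ 4 * (M * (v ^+ 2) ^+ 2))).
  by rewrite ler_wpM2l // divr_ge0 ?exprn_ge0 ?(ltW v0).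
by rewrite le_eqVlt; apply/orP; left; apply/eqP; field; rewrite gt_eqF.
Qed.

End FixedOrder.

(** Hides the explicit constant; the quantifier order keeps it independent of [n], [u] and [j]. *)
Lemma mean_deficiency_pow_le : exists2 M : K, 0 <= M &
  forall (n : nat) (u : K) j, 1 <= u -> u ^+ 4 = n%:R -> (j <= 4)%N ->
    mean R (fun E : {set {set 'I_n}} => d E ^+ j) <= M * u ^+ (2 * j).
Proof.
eexists; last by move=> n u j u1 un j4; exact: mean_moment_le.
by rewrite !(addr_ge0, mulr_ge0, exprn_ge0, ler0n, ler01).
Qed.

(** One step down from j = 1, then q_1 <= d and the moment of order i + 2, which is available up to
    4. *)
Lemma mean_num_deficient2_le : exists2 C : K, 0 <= C &
  forall (n : nat) (u : K) i, 1 <= u -> u ^+ 4 = n%:R -> (i <= 2)%N ->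
    mean R (fun E : {set {set 'I_n}} => d E ^+ i * q 2 E) <= C * u ^+ (2 * i).
Proof.
have [M M0 dM] := mean_deficiency_pow_le; exists ((r + 3) * M) => [|n u i u1 un i2].
  by rewrite mulr_ge0 // addr_ge0 ?ler0n.
have u40 : 0 < u ^+ 4 by rewrite exprn_gt0 //; lra.
have H1 := @mean_deficient_step n i 1 isT.
have H2 : mean R (fun E : {set {set 'I_n}} => d E ^+ i.+1 * q 1 E) <=
    mean R (fun E : {set {set 'I_n}} => d E ^+ i.+2).
  apply: mean_le => E GE; rewrite [leRHS]exprSr ler_wpM2l ?exprn_ge0 ?deficiency_ge0 //.
  exact: num_deficient_le_deficiency.
have H3 := dM n u i.+2 u1 un i2.
rewrite -(ler_pM2l u40) {1}un; apply: le_trans H1 _.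
have -> : u ^+ 4 * ((r + 3) * M * u ^+ (2 * i)) = (r + 3) * (M * u ^+ (2 * i.+2)).
  by rewrite !mulnS !exprD; ring.
by rewrite ler_wpM2l ?addr_ge0 ?ler0n //; exact: le_trans H2 H3.
Qed.

(** A second step down, from E[d q] = O(u^2), divided by n = u^4. *)
Lemma mean_num_deficient3_le : exists2 C : K, 0 <= C &
  forall (n : nat) (u : K), 1 <= u -> u ^+ 4 = n%:R ->
    u ^+ 2 * mean R (fun E : {set {set 'I_n}} => q 3 E) <= C.
Proof.
have [C C0 qC] := mean_num_deficient2_le; exists ((r + 3) * C) => [|n u u1 un].
  by rewrite mulr_ge0 // addr_ge0 ?ler0n.
have u20 : 0 < u ^+ 2 by rewrite exprn_gt0 //; lra.
have H1 := @mean_deficient_step n 0 2 isT.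
have H2 := qC n u 1%N u1 un isT.
rewrite -(ler_pM2l u20) mulrA -exprD un.
rewrite (_ : mean _ _ = mean R (fun E : {set {set 'I_n}} => d E ^+ 0 * q 3 E)); last first.
  by apply: mean_eq => E _; rewrite mul1r.
apply: le_trans H1 _; rewrite [leRHS]mulrCA [u ^+ 2 * C]mulrC.
by rewrite ler_wpM2l ?addr_ge0 ?ler0n.
Qed.

(** * Concentration of the number of vertices of degree R - 1 *)

(** The double count with h = 1 and h(x) = x nearly determines the second moment from below and the
    third from above, which forces d close to t = sqrt(R n); then a is close to d because q is
    small. *)
Lemma mean_num_degree_deviation_le : exists2 C : K, 0 <= C &
  forall (n : nat) (u : K), 1 <= u -> u ^+ 4 = n%:R ->
    mean R (fun E : {set {set 'I_n}} => `|a E ^+ 2 - r * n%:R|) <= C * u ^+ 3.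
Proof.
have [M M0 dM] := mean_deficiency_pow_le; have [C C0 qC] := mean_num_deficient2_le.
have r2 := natr_ge2.
(* [C1] will bound E[d X] in units of u^4, [C2] will bound [W] in units of u^4, and [C3] will bound
   [Z] in units of u^3. *)
set C1 := 2 * r * C + (r + 1) * M.
set g := Num.sqrt r; have g0 : 0 <= g by exact: sqrtr_ge0.
have g2 : g ^+ 2 = r by rewrite sqr_sqrtr //; lra.
have C10 : 0 <= C1 by rewrite addr_ge0 // !mulr_ge0 //; lra.
set C2 := C1 + 2 * r + g * M.
have C20 : 0 <= C2 by rewrite !addr_ge0 // !mulr_ge0 //; lra.
set C3 := (C2 + M + g) / 2.
exists (C3 + 2 * (r + 1) * C) => [|n u u1 un].
  by rewrite addr_ge0 //; [rewrite /C3; lra | rewrite !mulr_ge0 //; lra].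
set N := n%:R; rewrite -/N in un; have u0 : 0 <= u by lra.
pose t := g * u ^+ 2; have t2 : t ^+ 2 = r * N by rewrite exprMn g2 -exprM un.
have t0 : 0 <= t by rewrite mulr_ge0 // exprn_ge0.
pose X (E : {set {set 'I_n}}) := d E ^+ 2 - addable_pairs K R E.
have m1 : mean R (fun E : {set {set 'I_n}} => d E) <= M * u ^+ 2 by exact: (dM n u 1%N).
have m2 : mean R (fun E : {set {set 'I_n}} => d E ^+ 2) <= M * u ^+ 4 by exact: (dM n u 2%N).
have q1 : mean R (fun E : {set {set 'I_n}} => d E * q 2 E) <= C * u ^+ 2 by exact: (qC n u 1%N).
have q2 : mean R (fun E : {set {set 'I_n}} => d E ^+ 2 * q 2 E) <= C * u ^+ 4 by exact: (qC n u 2%N).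
have X0 E : E \in bounded_graphs n R -> 0 <= X E.
  move=> GE; rewrite subr_ge0; apply: le_trans (addable_pairs_le K R E) _.
  by rewrite ler_pXn2r ?nnegrE ?ler0n ?deficiency_ge0 //; exact: num_deficient_le_deficiency.
have XE E : E \in bounded_graphs n R -> X E <= 2 * r * (d E * q 2 E) + (r + 1) * d E.
  move=> GE; have := addable_pairs_ge K GE; have := num_deficient_le_deficiency GE.
  have := deficiency_le K GE; have := num_deficient_ge0 1 E; have := num_deficient_ge0 2 E.
  rewrite /X.
  move: (d E) (q 1 E) (q 2 E) (addable_pairs K R E) => x s k P k0 s0 xs sx Ps.
  have A1 : (x - s) * (x + s) <= r * k * (2 * x).
    by apply: ler_pM; rewrite ?subr_ge0 //; lra.
  have A2 : (r + 1) * s <= (r + 1) * x by rewrite ler_wpM2l //; lra.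
  lra.
have id1 := @mean_remove_edge n (fun=> 1); have idx := @mean_remove_edge n id.
set M1 := mean R (fun E : {set {set 'I_n}} => d E) in m1.
set M2 := mean R (fun E : {set {set 'I_n}} => d E ^+ 2) in m2.
set Q1 := mean R (fun E : {set {set 'I_n}} => d E * q 2 E) in q1.
set Q2 := mean R (fun E : {set {set 'I_n}} => d E ^+ 2 * q 2 E) in q2.
pose M3 := mean R (fun E : {set {set 'I_n}} => d E ^+ 3).
pose P0 := mean R (fun E : {set {set 'I_n}} => addable_pairs K R E).
pose P1 := mean R (fun E : {set {set 'I_n}} => d E * addable_pairs K R E).
have E0 : r * N - M1 = P0.
  transitivity (mean R (fun E : {set {set 'I_n}} => 1 * (r * n%:R - d E))).
    rewrite (mean_eq (g := fun E => r * N - d E)) => [|E _]; last by rewrite mul1r.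
    by rewrite meanD mean_cst meanN.
  by rewrite id1; apply: mean_eq => E _; rewrite mul1r.
have E1 : r * N * M1 + 2 * r * N - M2 - 2 * M1 = P1.
  rewrite /P1 -idx.
  rewrite (mean_eq (g := fun E => r * N * d E + 2 * r * N - d E ^+ 2 - 2 * d E)) => [|E _].
    by rewrite !meanD mean_cst !meanN !meanZ.
  by rewrite /N; ring.
have X0m : 0 <= M2 - P0.
  by rewrite -meanN -meanD; apply: mean_ge0 => E GE; exact: X0.
have X1m : M3 - P1 <= 2 * r * Q2 + (r + 1) * M2.
  rewrite -meanN -!meanZ -!meanD; apply: mean_le => E GE.
  have := ler_wpM2l (deficiency_ge0 GE) (XE E GE); rewrite /X; lra.
have A1 : M3 - P1 <= C1 * u ^+ 4.
  have B1 := @ler_wpM2l _ (2 * r) _ _ _ q2; have B2 := @ler_wpM2l _ (r + 1) _ _ _ m2.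
  have {}B1 := B1 ltac:(lra); have {}B2 := B2 ltac:(lra).
  by apply: le_trans X1m _; rewrite /C1; lra.
have M1ge : 0 <= M1 by apply: mean_ge0 => E; exact: deficiency_ge0.
have M2ge : 0 <= M2 by apply: mean_ge0 => E _; exact: sqr_ge0.
have A2 : M3 - r * N * M1 <= (C1 + 2 * r) * u ^+ 4 by rewrite un in A1 *; lra.
have A3 : r * N - M2 <= M * u ^+ 2 by lra.
(* A nonnegative quantity vanishing only at d = t, whose expansion involves just the two
   combinations bounded in [A2] and [A3]. *)
pose W := mean R (fun E : {set {set 'I_n}} => (d E - t) ^+ 2 * (d E + t)).
have EW : W = M3 - r * N * M1 + t * (r * N - M2).
  rewrite /W (mean_eq (g := fun E => d E ^+ 3 - t ^+ 2 * d E + t ^+ 3 - t * d E ^+ 2)) => [|E _].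
    by rewrite !meanD mean_cst !meanN !meanZ -t2 -/M1 -/M2 -/M3; ring.
  by ring.
have A4 : W <= C2 * u ^+ 4.
  have := ler_wpM2l t0 A3; rewrite EW /C2 -/t.
  have -> : t * (M * u ^+ 2) = g * M * u ^+ 4 by rewrite /t; ring.
  lra.
pose Z := mean R (fun E : {set {set 'I_n}} => `|d E ^+ 2 - r * N|).
(* Factor d^2 - t^2 and bound u |d - t| by half of (d - t)^2 + u^2; this weight u makes both
   resulting terms O(u^4). *)
have A5 : u * Z <= (W + u ^+ 2 * (M1 + t)) / 2.
  have -> : (W + u ^+ 2 * (M1 + t)) / 2 = mean R (fun E : {set {set 'I_n}} =>
      2^-1 * ((d E - t) ^+ 2 * (d E + t)) + (2^-1 * u ^+ 2 * d E + 2^-1 * u ^+ 2 * t)).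
    by rewrite !meanD mean_cst !meanZ -/W -/M1; field.
  rewrite /Z -meanZ; apply: mean_le => E GE; have := deficiency_ge0 GE; rewrite -t2.
  move: (d E) => x x0; rewrite subr_sqr normrM (ger0_norm (_ : 0 <= x + t)); last by lra.
  have A : 0 <= x + t by lra.
  have B : u * `|x - t| <= 2^-1 * ((x - t) ^+ 2 + u ^+ 2).
    have := sqr_ge0 (`|x - t| - u); rewrite sqrrB real_normK ?num_real //; lra.
  by have := ler_wpM2r A B; lra.
have A6 : Z <= C3 * u ^+ 3.
  rewrite -(ler_pM2l (_ : 0 < u)); last by lra.
  apply: le_trans A5 _.
  have : u ^+ 2 * M1 <= u ^+ 2 * (M * u ^+ 2) by rewrite ler_wpM2l ?sqr_ge0.
  have -> : u * (C3 * u ^+ 3) = C3 * u ^+ 4 by ring.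
  have -> : u ^+ 2 * (M * u ^+ 2) = M * u ^+ 4 by ring.
  have : u ^+ 2 * t = g * u ^+ 4 by rewrite /t; ring.
  rewrite /C3; lra.
(* Passing from d to a costs d^2 - a^2, where d - a <= (R + 1) q and d + a <= 2 d. *)
have A7 : mean R (fun E : {set {set 'I_n}} => `|a E ^+ 2 - r * N|) <= Z + 2 * (r + 1) * Q1.
  rewrite -meanZ -meanD; apply: mean_le => E GE.
  have -> : a E ^+ 2 - r * N = (d E ^+ 2 - r * N) - (d E ^+ 2 - a E ^+ 2) by ring.
  apply: le_trans (ler_normB _ _) _; rewrite lerD2l.
  have := num_deficient_le_deficiency GE; have := deficiency_le K GE; rewrite (num_degree_predE).
  have := num_deficient_anti E (isT : (1 <= 2)%N); have := num_deficient_ge0 2 E.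
  move: (d E) (q 1 E) (q 2 E) => x s k k0 ks xs sx.
  rewrite subr_sqr normrM !ger0_norm; try lra.
  by apply: (@le_trans _ _ ((r + 1) * k * (2 * x))); [apply: ler_pM; lra | lra].
apply: le_trans A7 _.
have : u ^+ 2 <= u ^+ 3 by rewrite ler_weXn2l.
move=> /(ler_wpM2l C0) /(le_trans q1) H.
have B : 0 <= 2 * (r + 1) by lra.
by have := ler_wpM2l B H; lra.
Qed.

(** * The recursion for the number of vertices of degree R - 2 *)

(** Only v leaves the class: x falls from R to R - 1, not R - 2, and y keeps its degree. *)
Lemma num_degree_switch n (E : {set {set 'I_n}}) v x y :
  E \in bounded_graphs n R -> switchable R (fun e => e + 2 == R)%N E v x y ->
  num_degree E (R - 2) = (num_degree (edge_switch v x y E) (R - 2)).+1.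
Proof.
move=> /bounded_graphsP[gE _] /and5P[xyE /eqP dx /eqP dv yv vyE].
have xy := graph_edge_neq gE xyE.
have vx : v != x by apply/eqP => vx; rewrite vx dx in dv; lia.
rewrite /num_degree (cardsD1 v) inE -(eqn_add2r 2) subnK // dv eqxx add1n; congr _.+1.
apply: eq_card => w; rewrite !inE; have := degree_switch w xyE vyE; rewrite !inE.
case: (eqVneq w v) => [->|wv] /=; first by rewrite (negbTE vx) eq_sym (negbTE yv) /=; lia.
case: (eqVneq w x) => [->|wx] /=; first by rewrite (negbTE xy) dx /=; lia.
by case: (w == y) => /=; lia.
Qed.

Lemma switchings_approx n (E : {set {set 'I_n}}) : E \in bounded_graphs n R ->
  `|r * n%:R * (num_degree E (R - 2))%:R - switchings R K (fun e => e + 2 == R)%N E|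
    <= (r * d E + r * (r + 1)) * (num_degree E (R - 2))%:R.
Proof.
move=> GE; have cE : #|[set v | (degree E v + 2 == R)%N]%SET| = num_degree E (R - 2).
  by apply: eq_card => v; rewrite !inE; lia.
have := switchings_ge K (fun e => e + 2 == R)%N GE.
have := switchings_le K (fun e => e + 2 == R)%N GE; rewrite cE.
have := num_deficient_le_deficiency GE; have b0 : 0 <= (num_degree E (R - 2))%:R :> K by exact: ler0n.
move: (_%:R : K) b0 (switchings _ _ _ _) (d E) (q 1 E) => b b0 F x s sx Fle Fge.
rewrite ger0_norm ?subr_ge0 //.
have := ler_wpM2r b0 (ler_wpM2l (ler0n K R) sx); lra.
Qed.

(** After a switch both x and v have degree R - 1, so there are a choices for each, and R - 1
    choices of y adjacent to v. *)
Lemma unswitchings_approx n (E : {set {set 'I_n}}) : E \in bounded_graphs n R ->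
  `|(r - 1) * a E ^+ 2 - unswitchings R K (fun e => e + 2 == R)%N E|
    <= r * (r + 2) * d E.
Proof.
move=> GE; have := unswitchings_ge K (fun e => e + 2 == R)%N GE.
have := unswitchings_le K (fun e => e + 2 == R)%N GE; rewrite sum_degree_pred //.
have sh e : pred_shift (fun e => e + 2 == R)%N e = (e.+1 == R).
  by case: e => [|e] /=; apply/eqP/eqP; lia.
have -> : \sum_v (pred_shift (fun e => e + 2 == R)%N (degree E v))%:R * (degree E v)%:R =
    (r - 1) * a E.
  rewrite -(sum_degree_pred) mulr_sumr; apply: eq_bigr => v _; rewrite sh.
  case: eqP => [<-|_]; last by rewrite mul0r mulr0.
  by rewrite -natr1 addrK mul1r mulr1.
have -> : \sum_v (pred_shift (fun e => e + 2 == R)%N (degree E v))%:R *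
    (a E * (degree E v)%:R - r * (r + 2)) = a E * (a E * (r - 1) - r * (r + 2)).
  rewrite -{2}(sum_degree_pred) mulr_suml; apply: eq_bigr => v _; rewrite sh.
  case: eqP => [<-|_]; last by rewrite !mul0r.
  by rewrite -natr1 addrK.
have := num_deficient_le_deficiency GE; have := num_degree_predE E; have := num_deficient_ge0 2 E.
have r2 := natr_ge2.
move: (unswitchings _ _ _ _) (d E) (q 1 E) (q 2 E) (a E) => B x s k b k0 bE sx Ble Bge.
rewrite ger0_norm; last by lra.
have c0 : 0 <= r * (r + 2) by rewrite mulr_ge0; lra.
have bx : b <= x by lra.
by have := ler_wpM2l c0 bx; lra.
Qed.

(** Switchings from graphs with k + 1 such vertices lead to graphs with k. The two counts are about
    (k + 1) R n and (R - 1) a^2, with a^2 close to R n; the error O(u^3) divided by n = u^4 leaves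
    O(1/u). *)
Lemma poisson_recursion k : exists2 C : K, 0 <= C &
  forall (n : nat) (u : K), 1 <= u -> u ^+ 4 = n%:R ->
   u * `|k.+1%:R * mean R (fun E : {set {set 'I_n}} => (num_degree E (R - 2) == k.+1)%:R) -
    (r - 1) * mean R (fun E : {set {set 'I_n}} => (num_degree E (R - 2) == k)%:R)| <= C.
Proof.
have [M M0 dM] := mean_deficiency_pow_le; have [Z Z0 aZ] := mean_num_degree_deviation_le.
have r2 := natr_ge2; have k0 : 0 <= k.+1%:R :> K by exact: ler0n.
have c0 : 0 <= k.+1%:R * r + r * (r + 2).
  by rewrite addr_ge0 ?mulr_ge0 ?ler0n //; lra.
exists ((k.+1%:R * r + r * (r + 2)) * M + k.+1%:R * (r * (r + 1)) + (r - 1) * Z).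
  by rewrite addr_ge0 ?mulr_ge0 //; [rewrite addr_ge0 ?mulr_ge0 //; lra | lra].
move=> n u u1 un; pose N : K := n%:R; pose T := (fun e => e + 2 == R)%N.
have m1 : mean R (fun E : {set {set 'I_n}} => d E) <= M * u ^+ 2 by exact: (dM n u 1%N).
have mz := aZ n u u1 un.
set M1 := mean _ _ in m1; set MZ := mean _ _ in mz.
pose w i (E : {set {set 'I_n}}) : K := (num_degree E (R - 2) == i)%:R.
have sw : mean R (fun E => w k.+1 E * switchings R K T E) =
    mean R (fun E => w k E * unswitchings R K T E).
  apply: mean_switch => [e /eqP|E v x y GE sE]; first by lia.
  by rewrite /w (num_degree_switch GE sE) eqSS.
rewrite -/(w k.+1) -/(w k); set X := _ - _.
(* The two switching terms have equal means by [sw], so inserting them changes nothing and each main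
   term can be compared with its own count. *)
have EX : r * N * X = mean R (fun E => (k.+1%:R * (r * N) * w k.+1 E - w k.+1 E * switchings R K T E)
    - ((r - 1) * (r * N) * w k E - w k E * unswitchings R K T E)).
  by rewrite !(meanD, meanN) !meanZ sw /X; ring.
have B : `|r * N * X| <= k.+1%:R * (r * M1 + r * (r + 1)) + ((r - 1) * MZ + r * (r + 2) * M1).
  rewrite EX; apply: le_trans (mean_norm _ _) _.
  have -> : k.+1%:R * (r * M1 + r * (r + 1)) + ((r - 1) * MZ + r * (r + 2) * M1) =
      mean R (fun E : {set {set 'I_n}} => (k.+1%:R * r * d E + k.+1%:R * (r * (r + 1))) +
       ((r - 1) * `|a E ^+ 2 - r * N| + r * (r + 2) * d E)).
    by rewrite !meanD mean_cst !meanZ -/M1 -/MZ; ring.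
  apply: mean_le => E GE; apply: le_trans (ler_normB _ _) _; apply: lerD.
    rewrite /w; have x0 := deficiency_ge0 GE; have := switchings_approx GE.
    case: eqP => [->|_] H; last first.
      by rewrite mulr0 mul0r subrr normr0; apply: addr_ge0; rewrite !mulr_ge0 //; lra.
    by rewrite mulr1 mul1r [_ * (r * N)]mulrC; apply: le_trans H _; lra.
  rewrite /w; have x0 := deficiency_ge0 GE; have H := unswitchings_approx GE.
  case: (_ == k); last first.
    by rewrite mulr0 mul0r subrr normr0; apply: addr_ge0; rewrite !mulr_ge0 //; lra.
  rewrite mulr1 mul1r.
  have -> : (r - 1) * (r * N) - unswitchings R K T E =
     - ((r - 1) * (a E ^+ 2 - r * N)) + ((r - 1) * a E ^+ 2 - unswitchings R K T E) by ring.
  apply: le_trans (ler_normD _ _) _; apply: lerD; last exact: H.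
  by rewrite normrN normrM ger0_norm //; lra.
have u3 : 0 < u ^+ 3 by rewrite exprn_gt0; lra.
have u23 : u ^+ 2 <= u ^+ 3 by rewrite ler_weXn2l.
have u13 : 1 <= u ^+ 3 by rewrite exprn_ege1.
rewrite -(ler_pM2l u3) [leLHS]mulrA -exprSr un -/N.
have N0 : 0 <= N * `|X| by rewrite mulr_ge0.
apply: (@le_trans _ _ `|r * N * X|).
  by rewrite !normrM normr_nat (ger0_norm (_ : 0 <= N)) // -mulrA ler_peMl //; lra.
apply: le_trans B _.
have B1 := ler_wpM2l c0 (le_trans m1 (ler_wpM2l M0 u23)).
have B2 : k.+1%:R * (r * (r + 1)) * 1 <= k.+1%:R * (r * (r + 1)) * u ^+ 3.
  by rewrite ler_wpM2l // !mulr_ge0 //; lra.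
have B3 : (r - 1) * MZ <= (r - 1) * (Z * u ^+ 3) by rewrite ler_wpM2l //; lra.
lra.
Qed.

End Moments.

(** * From the recursion and tightness to the Poisson limit *)

(** The recursion makes p_k asymptotic to lam^k / k! times p_0. As almost all mass lies on k <= m
    uniformly in large n, summing gives e^lam p_0 -> 1. *)
Lemma poisson_limit (K : realType) (lam C : K) (p : nat -> nat -> K) :
  (forall k n, 0 <= p k n) ->
  (forall k, (k.+1%:R * p k.+1 n - lam * p k n) @[n --> \oo] --> (0 : K)) ->
  (forall m, \forall n \near \oo, 1 - C / m.+1%:R <= \sum_(k < m.+1) p k n <= 1) ->
  forall k, p k n @[n --> \oo] --> lam ^+ k * expR (- lam) / k`!%:R.
Proof.
move=> p0 rec tail.
have cvg0 k : (p k n - exp_coeff lam k * p 0%N n) @[n --> \oo] --> (0 : K).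
  elim: k => [|k IH].
    rewrite (_ : (fun n => _) = fun=> 0); first exact: cvg_cst.
    by apply/funext => n; rewrite /exp_coeff /= fact0 expr0 divr1 mul1r subrr.
  rewrite (_ : (fun n => _) = (fun n => k.+1%:R^-1 * ((k.+1%:R * p k.+1 n - lam * p k n) +
      lam * (p k n - exp_coeff lam k * p 0%N n)))); last first.
    apply/funext => n; rewrite /exp_coeff /= factS natrM exprS; field.
    by rewrite nat1r !pnatr_eq0 -lt0n fact_gt0.
  rewrite -(mulr0 k.+1%:R^-1); apply: cvgMl_tmp.
  rewrite -[X in _ --> X](addr0 0) -[X in _ --> _ + X](mulr0 lam); apply: cvgD; first exact: rec.
  exact: cvgMl_tmp.
have cvgS m : (\sum_(k < m) p k n - series (exp_coeff lam) m * p 0%N n) @[n --> \oo] --> (0 : K).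
  elim: m => [|m IH].
    rewrite (_ : (fun n => _) = fun=> 0); first exact: cvg_cst.
    by apply/funext => n; rewrite /series /= big_ord0 big_geq // mul0r subrr.
  rewrite (_ : (fun n => _) = (fun n => (\sum_(k < m) p k n - series (exp_coeff lam) m * p 0%N n) +
      (p m n - exp_coeff lam m * p 0%N n))); last first.
    by apply/funext => n; rewrite /series /= big_ord_recr big_nat_recr //=; ring.
  by rewrite -[X in _ --> X](addr0 0); exact: cvgD.
have p0cvg : (expR lam * p 0%N n) @[n --> \oo] --> (1 : K).
  apply/cvgrPdist_le => e e0; pose h := e / 3; have h0 : 0 < h by rewrite divr_gt0.
  have /cvgrPdist_le/(_ h h0) exph : series (exp_coeff lam) @ \oo --> expR lam.
    exact: is_cvg_series_exp_coeff.
  (* [m] is fixed before [n], making both the tail of the exponential series and the mass beyond m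
     at most e / 3; the last third goes to [cvgS]. *)
  have [m [hm Cm]] : exists m, `|expR lam - series (exp_coeff lam) m.+1| <= h /\ C / m.+1%:R <= h.
    have [m1 _ Hm1] := exph; have [m2 _ Hm2] := nbhs_infty_ger (C / h).
    exists (maxn m1 m2); split; first by apply: Hm1 => /=; rewrite ltnW // ltnS leq_maxl.
    rewrite ler_pdivrMr ?ltr0n // mulrC -ler_pdivrMr //.
    by apply: Hm2 => /=; rewrite ltnW // ltnS leq_maxr.
  have /cvgrPdist_le/(_ h h0) Sm := cvgS m.+1.
  near=> n.
  have /andP[T1 T2] : 1 - C / m.+1%:R <= \sum_(k < m.+1) p k n <= 1.
    by near: n; exact: tail.
  have S1 : `|0 - (\sum_(k < m.+1) p k n - series (exp_coeff lam) m.+1 * p 0%N n)| <= h.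
    by near: n; exact: Sm.
  have p01 : p 0%N n <= 1.
    by apply: le_trans T2; rewrite big_ord_recl lerDl; apply: sumr_ge0 => i _; exact: p0.
  have B : `|(expR lam - series (exp_coeff lam) m.+1) * p 0%N n| <= h.
    rewrite normrM (ger0_norm (p0 _ _)); apply: le_trans hm.
    by rewrite ler_piMr.
  have lin (c s f x t y : K) : 1 - c <= s -> s <= 1 -> c <= y -> `|0 - (s - f * x)| <= y ->
      `|(t - f) * x| <= y -> `|1 - t * x| <= 3 * y.
    move=> cs s1 cy /ler_normlP[A1 A2] /ler_normlP[B1 B2].
    by apply/ler_normlP; split; lra.
  rewrite [e](_ : _ = 3 * h); first exact: lin T1 T2 Cm S1 B.
  by rewrite mulrC divfK // pnatr_eq0.
move=> k; rewrite (_ : (fun n => p k n) = (fun n => (p k n - exp_coeff lam k * p 0%N n) +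
   exp_coeff lam k * expR (- lam) * (expR lam * p 0%N n))); last first.
  apply/funext => n; rewrite expRN; field; rewrite gt_eqF ?expR_gt0 //.
rewrite (_ : _ / _ = 0 + exp_coeff lam k * expR (- lam) * 1); last first.
  by rewrite /exp_coeff /= add0r mulr1 mulrAC.
by apply: cvgD; [exact: cvg0 | exact: cvgMl_tmp].
Unshelve. all: by end_near.
Qed.

(** * Fourth roots, Markov's inequality and the three limits *)

(** The lower bound [c] turns an estimate of order 1/u into one below a prescribed e for all large
    n. *)
Lemma fourth_root_near (K : realType) (c : K) : \forall n \near \oo,
  exists u : K, [/\ 1 <= u, u ^+ 4 = n%:R & c <= u].
Proof.
near=> n; exists (Num.sqrt (Num.sqrt n%:R)).
have mn : Num.max 1 c ^+ 4 <= n%:R :> K by near: n; exact: nbhs_infty_ger.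
have m0 : 0 <= Num.max 1 c by rewrite le_max ler01.
have : Num.max 1 c <= Num.sqrt (Num.sqrt n%:R).
  have -> : Num.max 1 c = Num.sqrt (Num.sqrt (Num.max 1 c ^+ 4)).
    by rewrite (exprM _ 2 2) sqrtr_sqr ger0_norm ?sqr_ge0 // sqrtr_sqr ger0_norm.
  by rewrite !ler_wsqrtr.
rewrite ge_max => /andP[u1 cu]; split=> //.
by rewrite (exprM _ 2 2) !sqr_sqrtr // sqrtr_ge0.
Unshelve. all: by end_near.
Qed.

Lemma proportion_le1 (K : realType) n R (P : {set {set 'I_n}} -> bool) :
  proportion K R P <= 1.
Proof.
rewrite proportionE -[leRHS](mean_cst n R 1); apply: mean_le => E _.
by rewrite /= lern1 leq_b1.
Qed.

Lemma markov (K : realType) n R (P : {set {set 'I_n}} -> bool) (f : {set {set 'I_n}} -> K) (c : K) :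
  (forall E, E \in bounded_graphs n R -> 0 <= f E) ->
  (forall E, E \in bounded_graphs n R -> ~~ P E -> c <= f E) ->
  c * (1 - proportion K R P) <= mean R f.
Proof.
move=> f0 fc; rewrite proportionE -[X in X - _](mean_cst n R 1) -meanN -meanD -meanZ.
apply: mean_le => E GE; case: (boolP (P E)) => PE /=.
  by rewrite subrr mulr0 f0.
by rewrite subr0 mulr1 fc.
Qed.

(* [Num.sqrt x = 0] for [x < 0], so the lower bound in (ii) is 0 when
   [eps > R]. *)
Theorem theorem2p1 (K : realType) (R : nat) (hR : (2 <= R)%N) :
  [/\ proportion K R (fun E : {set {set 'I_n}} =>
         ~~ [exists v, (degree E v < R - 2)%N]) @[n --> \oo] --> (1 : K),
      forall eps : K, 0 < eps ->
        proportion K R (fun E : {set {set 'I_n}} =>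
          Num.sqrt ((R%:R - eps) * n%:R) <= ((num_degree E (R - 1))%:R : K)
            <= Num.sqrt ((R%:R + eps) * n%:R)) @[n --> \oo] --> (1 : K)
    & forall k : nat,
        proportion K R (fun E : {set {set 'I_n}} =>
          num_degree E (R - 2) == k) @[n --> \oo]
        --> ((R%:R - 1) ^+ k * expR (- (R%:R - 1)) / k`!%:R : K)].
Proof.
split.
(* Part (i): a bad graph has at least one vertex of degree at most R - 3, and the expected number of
   those is O(u^-2). *)
- have [C C0 qC] := mean_num_deficient3_le K hR; apply/cvgrPdist_le => e e0.
  near=> n; have [u [u1 un Cu]] : exists u : K, [/\ 1 <= u, u ^+ 4 = n%:R & C / e <= u].
    by near: n; exact: fourth_root_near.
  set P := fun E => _; have P1 := proportion_le1 K R P.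
  rewrite ger0_norm ?subr_ge0 //.
  have u20 : 0 < u ^+ 2 by rewrite exprn_gt0 //; lra.
  rewrite -(ler_pM2l u20); apply: (@le_trans _ _ C); last first.
    by rewrite mulrC -ler_pdivrMl // mulrC (le_trans Cu) // expr2 ler_peMr //; lra.
  apply: le_trans (qC n u u1 un); rewrite ler_pM2l //.
  rewrite -[leLHS]mul1r; apply: markov => E GE; first exact: ler0n.
  rewrite negbK => /existsP[v dv]; rewrite ler1n; apply/card_gt0P; exists v.
  by rewrite inE; lia.
(* Part (ii): a bad graph has |a^2 - R n| >= eps n, while the mean of this deviation is
   O(n^{3/4}). *)
- move=> eps eps0; have [C C0 aC] := mean_num_degree_deviation_le K hR; apply/cvgrPdist_le => e e0.
  near=> n; have [u [u1 un Cu]] : exists u : K, [/\ 1 <= u, u ^+ 4 = n%:R & C / (eps * e) <= u].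
    by near: n; exact: fourth_root_near.
  set P := fun E => _; have P1 := proportion_le1 K R P.
  rewrite ger0_norm ?subr_ge0 //.
  have u30 : 0 < u ^+ 3 by rewrite exprn_gt0 //; lra.
  have Ce : C <= eps * e * u by rewrite mulrC -ler_pdivrMr ?mulr_gt0.
  have en0 : 0 < eps * n%:R by rewrite mulr_gt0 // -un exprn_gt0 //; lra.
  rewrite -(ler_pM2l en0); apply: (@le_trans _ _ (C * u ^+ 3)); last first.
    by rewrite -un; have := ler_wpM2r (ltW u30) Ce; lra.
  apply: le_trans (aC n u u1 un); apply: markov => E GE; first exact: normr_ge0.
  apply: contraNT; rewrite -ltNge ltr_norml => /andP[lo hi].
  have a0 : 0 <= (num_degree E (R - 1))%:R :> K by exact: ler0n.
  (* [Num.sqrt] is monotone on all reals, so eps > R falls under the same argument. *)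
  apply/andP; split; rewrite -[X in X <= _](ger0_norm) ?sqrtr_ge0 //.
    rewrite ger0_norm ?sqrtr_ge0 // -[leRHS]ger0_norm // -sqrtr_sqr ler_wsqrtr //.
    by lra.
  by rewrite -sqrtr_sqr ler_wsqrtr //; lra.
(* Part (iii): the bound E[q] <= C, from i = 0, supplies the tightness required by
   [poisson_limit]. *)
have [C C0 qC] := mean_num_deficient2_le K hR.
apply: (@poisson_limit _ _ C (fun k n => proportion K R (fun E : {set {set 'I_n}} =>
   num_degree E (R - 2) == k))).
- by move=> k n; rewrite divr_ge0 ?ler0n.
- move=> k; have [B B0 HB] := poisson_recursion K hR k; apply/cvgrPdist_le => e e0.
  near=> n; have [u [u1 un Cu]] : exists u : K, [/\ 1 <= u, u ^+ 4 = n%:R & B / e <= u].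
    by near: n; exact: fourth_root_near.
  rewrite sub0r normrN !proportionE.
  have u0 : 0 < u by lra.
  rewrite -(ler_pM2l u0); apply: le_trans (HB n u u1 un) _.
  by rewrite -ler_pdivrMr.
move=> m; near=> n.
have [u [u1 un _]] : exists u : K, [/\ 1 <= u, u ^+ 4 = n%:R & 0 <= u].
  by near: n; exact: fourth_root_near.
(* The partial sum is the probability of at most m vertices of degree R - 2; its complement forces q
   >= m + 1. *)
have -> : \sum_(k < m.+1) proportion K R (fun E : {set {set 'I_n}} => num_degree E (R - 2) == k) =
    proportion K R (fun E : {set {set 'I_n}} => (num_degree E (R - 2) < m.+1)%N).
  under eq_bigr do rewrite proportionE.
  rewrite -mean_sum proportionE; apply: mean_eq => E _.
  case: ltnP => bm.
    rewrite (bigD1 (Ordinal bm)) //= eqxx big1 ?addr0 // => i.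
    by rewrite -val_eqE /= eq_sym => /negbTE ->.
  rewrite big1 // => i _; case: eqP => // bi.
  by have := ltn_ord i; rewrite ltnNge -bi bm.
rewrite proportion_le1 andbT lerBlDr -lerBlDl ler_pdivlMr ?ltr0n // mulrC.
have := qC n u 0%N u1 un isT; rewrite muln0 expr0 mulr1; apply: le_trans.
apply: markov => E GE; first by rewrite mul1r.
rewrite -leqNgt mul1r ler_nat => /leq_trans; apply.
by rewrite -(@num_degreeE n R 2) // leq_addr.
Unshelve. all: by end_near.
Qed.
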